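(* Let $\mathcal A$ be the variety of abelian groups. Let $X_1,\dots,X_n$ be finite loops in which associativity propagates and such that for every $i$, every subloop $Y\le X_i$ is either an abelian group or a nonabelian simple loop. Then associativity propagates in $\mathbf{HSP}(X_1,\dots,X_n)\lor\mathcal A$.
   Context: A loop is an algebra $(X,\cdot,\backslash,/,e)$ satisfying $x(x\backslash y)=y=x\backslash(xy)$, $(x/y)y=x=(xy)/y$ and $ex=xe=x$; abelian groups are regarded as loops in this signature. A normal subloop is the kernel of a loop homomorphism. A loop is abelian if it is an abelian group, and nonabelian otherwise (so a nonabelian loop may be commutative). A loop $X$ is simple if its only normal subloops are $\{e\}$ and $X$. $\mathbf{HSP}(X_1,\dots,X_n)$ is the smallest variety containing $X_1,\dots,X_n$, and $\mathcal V_1\lor\mathcal V_2$ is the smallest variety containing $\mathcal V_1\cup\mathcal V_2$. Associativity propagates in a loop $X$ if for all $x,y,z\in X$ with $x(yz)=(xy)z$, the identity $u(vw)=(uv)w$ holds for all $u,v,w$ in the subloop of $X$ generated by $x,y,z$. Associativity propagates in a class of loops if it propagates in every member of the class. *)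

(* Defs.v *)
From mathcomp Require Import all_boot.
From mathcomp Require Import boolp classical_sets functions cardinality.

Set Implicit Arguments.
Unset Strict Implicit.
Unset Printing Implicit Defensive.

Local Open Scope classical_set_scope.

Declare Scope loop_scope.
Delimit Scope loop_scope with L.

Record loop := Loop {
  carrier :> Type;
  lmul : carrier -> carrier -> carrier;
  ldiv : carrier -> carrier -> carrier;
  rdiv : carrier -> carrier -> carrier;
  lone : carrier;
  lmulKdiv : forall x y, lmul x (ldiv x y) = y;
  ldivKmul : forall x y, ldiv x (lmul x y) = y;
  rdivKmul : forall x y, lmul (rdiv x y) y = x;
  rmulKdiv : forall x y, rdiv (lmul x y) y = x;
  lmul1x : forall x, lmul lone x = x;
  lmulx1 : forall x, lmul x lone = x
}.

Arguments lone {l}.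

Infix "*" := lmul : loop_scope.
Infix "\\" := ldiv (at level 40, left associativity) : loop_scope.
Infix "/" := rdiv : loop_scope.

Local Open Scope loop_scope.

Definition loop_hom (X Y : loop) (f : X -> Y) : Prop :=
  [/\ forall x y, f (x * y) = f x * f y,
      forall x y, f (x \\ y) = f x \\ f y,
      forall x y, f (x / y) = f x / f y
    & f lone = lone].

Definition is_subloop (X : loop) (S : set X) : Prop :=
  [/\ forall x y, S x -> S y -> S (x * y),
      forall x y, S x -> S y -> S (x \\ y),
      forall x y, S x -> S y -> S (x / y)
    & S lone].

Section SubloopAsLoop.
Variables (X : loop) (S : set X) (HS : is_subloop S).

Let T := {x : X | S x}.

Definition sub_mul (x y : T) : T :=
  exist _ (sval x * sval y)
    (let: And4 h _ _ _ := HS in h _ _ (svalP x) (svalP y)).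
Definition sub_ldiv (x y : T) : T :=
  exist _ (sval x \\ sval y)
    (let: And4 _ h _ _ := HS in h _ _ (svalP x) (svalP y)).
Definition sub_rdiv (x y : T) : T :=
  exist _ (sval x / sval y)
    (let: And4 _ _ h _ := HS in h _ _ (svalP x) (svalP y)).
Definition sub_one : T :=
  exist _ lone (let: And4 _ _ _ h := HS in h).

Fact sub_lmulKdiv x y : sub_mul x (sub_ldiv x y) = y.
Proof. by case: x y => [x ?] [y ?]; apply: eq_exist; apply: lmulKdiv. Qed.
Fact sub_ldivKmul x y : sub_ldiv x (sub_mul x y) = y.
Proof. by case: x y => [x ?] [y ?]; apply: eq_exist; apply: ldivKmul. Qed.
Fact sub_rdivKmul x y : sub_mul (sub_rdiv x y) y = x.
Proof. by case: x y => [x ?] [y ?]; apply: eq_exist; apply: rdivKmul. Qed.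
Fact sub_rmulKdiv x y : sub_rdiv (sub_mul x y) y = x.
Proof. by case: x y => [x ?] [y ?]; apply: eq_exist; apply: rmulKdiv. Qed.
Fact sub_mul1x x : sub_mul sub_one x = x.
Proof. by case: x => [x ?]; apply: eq_exist; apply: lmul1x. Qed.
Fact sub_mulx1 x : sub_mul x sub_one = x.
Proof. by case: x => [x ?]; apply: eq_exist; apply: lmulx1. Qed.

Definition subloop : loop :=
  Loop sub_lmulKdiv sub_ldivKmul sub_rdivKmul sub_rmulKdiv sub_mul1x sub_mulx1.

End SubloopAsLoop.

Section ProductLoop.
Variables (I : Type) (X : I -> loop).

Let T := forall i, X i.

Definition prod_mul (x y : T) : T := fun i => x i * y i.
Definition prod_ldiv (x y : T) : T := fun i => x i \\ y i.
Definition prod_rdiv (x y : T) : T := fun i => x i / y i.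
Definition prod_one : T := fun=> lone.

Fact prod_lmulKdiv x y : prod_mul x (prod_ldiv x y) = y.
Proof. by apply: functional_extensionality_dep => i; apply: lmulKdiv. Qed.
Fact prod_ldivKmul x y : prod_ldiv x (prod_mul x y) = y.
Proof. by apply: functional_extensionality_dep => i; apply: ldivKmul. Qed.
Fact prod_rdivKmul x y : prod_mul (prod_rdiv x y) y = x.
Proof. by apply: functional_extensionality_dep => i; apply: rdivKmul. Qed.
Fact prod_rmulKdiv x y : prod_rdiv (prod_mul x y) y = x.
Proof. by apply: functional_extensionality_dep => i; apply: rmulKdiv. Qed.
Fact prod_mul1x x : prod_mul prod_one x = x.
Proof. by apply: functional_extensionality_dep => i; apply: lmul1x. Qed.
Fact prod_mulx1 x : prod_mul x prod_one = x.
Proof. by apply: functional_extensionality_dep => i; apply: lmulx1. Qed.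

Definition prod_loop : loop :=
  Loop prod_lmulKdiv prod_ldivKmul prod_rdivKmul prod_rmulKdiv
       prod_mul1x prod_mulx1.

End ProductLoop.

(* Classes of loops are plain predicates rather than `set loop`, which would put
   the universe of loop carriers strictly below that of `set`.
   Closure under isomorphic copies is the bijective case of the first clause.
   The empty product makes every variety nonempty. *)
Definition is_variety (V : loop -> Prop) : Prop :=
  [/\ forall (X Y : loop) (f : X -> Y),
        loop_hom f -> (forall y, exists x, f x = y) -> V X -> V Y,
      forall (X : loop) (S : set X) (HS : is_subloop S),
        V X -> V (subloop HS)
    & forall (I : Type) (X : I -> loop),
        (forall i, V (X i)) -> V (prod_loop X)].

Definition smallest_variety (K : loop -> Prop) : loop -> Prop :=
  fun X => forall V, is_variety V -> (forall Y, K Y -> V Y) -> V X.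

Definition HSP (n : nat) (X : 'I_n -> loop) : loop -> Prop :=
  smallest_variety (fun Y => exists i, Y = X i).

Definition variety_join (V W : loop -> Prop) : loop -> Prop :=
  smallest_variety (fun X => V X \/ W X).

Definition is_abelian (X : loop) : Prop :=
  (forall x y z : X, x * (y * z) = (x * y) * z) /\
  (forall x y : X, x * y = y * x).

Definition abelian_groups : loop -> Prop := is_abelian.

Definition is_normal (X : loop) (N : set X) : Prop :=
  exists (Y : loop) (f : X -> Y),
    loop_hom f /\ N = [set x | f x = lone].

(* The trivial loop is simple in this sense, but it is abelian. *)
Definition is_simple (X : loop) : Prop :=
  forall N : set X, is_normal N -> N = [set lone] \/ N = [set: X].

Definition generated (X : loop) (G : set X) : set X :=
  smallest (@is_subloop X) G.

Definition assoc_propagates (X : loop) : Prop :=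
  forall x y z : X, x * (y * z) = (x * y) * z ->
  forall u v w : X,
    generated [set x; y; z] u -> generated [set x; y; z] v ->
    generated [set x; y; z] w ->
    u * (v * w) = (u * v) * w.

Definition assoc_propagates_in (V : loop -> Prop) : Prop :=
  forall X, V X -> assoc_propagates X.

(* Main.v *)
(** A triple in a member of the join gives a congruence [N] on the loop terms in
    three variables.  [N] contains [K] meet [M], where [K] is the intersection of
    the finitely many kernels [K_j] of evaluations at non-associating triples of
    the [X i], and [M] that of the evaluations at associating triples and in
    abelian groups, so that terms associate modulo [M].  If [N] relates the two
    bracketings of the variables then it is not below any [K_j]; these are
    maximal, so [N] composed with [K_j] is the full relation.  As the quotients
    by the [K_j] are simple and not associative, a commutator argument shows that
    [N] composed with [K] is full too.  Hence any term is [N]-congruent to one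
    that is trivial modulo [K]; this one associates with all terms modulo both
    [K] and [M], hence modulo [N]. *)

Require Import Defs.
From mathcomp Require Import all_boot.
From mathcomp Require Import boolp classical_sets functions cardinality.

Set Implicit Arguments.
Unset Strict Implicit.
Unset Printing Implicit Defensive.

Local Open Scope classical_set_scope.

(** * Loop terms in three variables and their values *)

Inductive term :=
  | Var1 | Var2 | Var3 | One
  | Mul of term & term | Ldiv of term & term | Rdiv of term & term.

Fixpoint eval (L : loop) (x y z : L) (t : term) : L :=
  match t with
  | Var1 => x
  | Var2 => y
  | Var3 => z
  | One => lone
  | Mul s t => lmul (eval x y z s) (eval x y z t)
  | Ldiv s t => ldiv (eval x y z s) (eval x y z t)
  | Rdiv s t => rdiv (eval x y z s) (eval x y z t)
  end.

Definition satisfies (L : loop) (s t : term) : Prop :=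
  forall x y z : L, eval x y z s = eval x y z t.

Lemma eval_hom (L L' : loop) (f : L -> L') (x y z : L) (t : term) :
  loop_hom f -> eval (f x) (f y) (f z) t = f (eval x y z t).
Proof.
case=> fM fL fR f1.
by elim: t => //= s -> t ->; rewrite ?fM ?fL ?fR.
Qed.

Lemma eval_sub (L : loop) (S : set L) (HS : is_subloop S)
    (x y z : subloop HS) (t : term) :
  sval (eval x y z t) = eval (sval x) (sval y) (sval z) t.
Proof. by elim: t => //= s -> t ->. Qed.

Lemma eval_prod (I : Type) (L : I -> loop) (x y z : prod_loop L) (t : term) i :
  eval x y z t i = eval (x i) (y i) (z i) t.
Proof. by elim: t => //= s <- t <-. Qed.

(** Since the models of a set of identities form a variety, identities valid in the generators hold
    throughout the smallest variety. *)
Lemma models_variety (E : term -> term -> Prop) :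
  is_variety (fun L => forall s t, E s t -> satisfies L s t).
Proof.
split=> [L L' f fhom fsurj EL s t st x y z|L S HS EL s t st x y z|I L EL s t st x y z].
- have [[x' <-] [y' <-] [z' <-]] := And3 (fsurj x) (fsurj y) (fsurj z).
  by rewrite !eval_hom // (EL s t st).
- by apply: eq_sig_hprop => [u p q|]; [exact: Prop_irrelevance | rewrite !eval_sub (EL s t st)].
- by apply: functional_extensionality_dep => i; rewrite !eval_prod (EL i s t st).
Qed.

Lemma eval_range_subloop (L : loop) (x y z : L) : is_subloop (range (eval x y z)).
Proof.
split=> [_ _ [s _ <-] [t _ <-]|_ _ [s _ <-] [t _ <-]|_ _ [s _ <-] [t _ <-]|].
- by exists (Mul s t).
- by exists (Ldiv s t).
- by exists (Rdiv s t).
- by exists One.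
Qed.

(** Turns propagation at a triple into a statement about terms: all terms associate modulo the
    kernel of the evaluation. *)
Lemma generated_eval (L : loop) (x y z : L) :
  generated [set x; y; z] = range (eval x y z).
Proof.
apply/seteqP; split=> u.
  apply; split; first exact: eval_range_subloop.
  by move=> _ [[->|->]|->]; [exists Var1 | exists Var2 | exists Var3].
case=> t _ <- S [[SM SL SR S1] gS].
elim: t => [||||s Ss t St|s Ss t St|s Ss t St] /=.
- by apply: gS; left; left.
- by apply: gS; left; right.
- by apply: gS; right.
- exact: S1.
- exact: SM.
- exact: SL.
- exact: SR.
Qed.

(** * Congruences, their meets and their composites *)

(* Congruences of the term algebra whose quotient is a loop. *)
Record loop_congr (R : term -> term -> Prop) : Prop := LoopCongr {
  lc_refl : forall s, R s s;
  lc_sym : forall s t, R s t -> R t s;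
  lc_trans : forall t s u, R s t -> R t u -> R s u;
  lc_mul : forall s s' t t', R s s' -> R t t' -> R (Mul s t) (Mul s' t');
  lc_ldiv : forall s s' t t', R s s' -> R t t' -> R (Ldiv s t) (Ldiv s' t');
  lc_rdiv : forall s s' t t', R s s' -> R t t' -> R (Rdiv s t) (Rdiv s' t');
  lc_lmulKdiv : forall s t, R (Mul s (Ldiv s t)) t;
  lc_ldivKmul : forall s t, R (Ldiv s (Mul s t)) t;
  lc_rdivKmul : forall s t, R (Mul (Rdiv s t) t) s;
  lc_rmulKdiv : forall s t, R (Rdiv (Mul s t) t) s;
  lc_mul1x : forall s, R (Mul One s) s;
  lc_mulx1 : forall s, R (Mul s One) s
}.

Definition full (R : term -> term -> Prop) : Prop := forall s t, R s t.

Definition meet (R S : term -> term -> Prop) s t : Prop := R s t /\ S s t.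

Definition comp (R S : term -> term -> Prop) s u : Prop :=
  exists2 t, R s t & S t u.

Definition associative_mod (R : term -> term -> Prop) : Prop :=
  forall s t u, R (Mul s (Mul t u)) (Mul (Mul s t) u).

Definition maximal_congr (R : term -> term -> Prop) : Prop :=
  forall S, loop_congr S -> (forall s t, R s t -> S s t) ->
  (forall s t, S s t -> R s t) \/ full S.

Lemma eval_congr (L : loop) (x y z : L) :
  loop_congr (fun s t => eval x y z s = eval x y z t).
Proof.
split=> //=.
- by move=> t s u -> ->.
- by move=> s s' t t' -> ->.
- by move=> s s' t t' -> ->.
- by move=> s s' t t' -> ->.
- by move=> s t; rewrite lmulKdiv.
- by move=> s t; rewrite ldivKmul.
- by move=> s t; rewrite rdivKmul.
- by move=> s t; rewrite rmulKdiv.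
- by move=> s; rewrite lmul1x.
- by move=> s; rewrite lmulx1.
Qed.

Lemma bigmeet_congr (J : Type) (D : J -> Prop) (R : J -> term -> term -> Prop) :
  (forall j, D j -> loop_congr (R j)) ->
  loop_congr (fun s t => forall j, D j -> R j s t).
Proof.
move=> cR; split.
- by move=> s j /cR/lc_refl.
- by move=> s t st j Dj; apply: (lc_sym (cR j Dj)); apply: st.
- by move=> t s u st tu j Dj; apply: (lc_trans (cR j Dj)); [apply: st | apply: tu].
- by move=> s s' t t' ss tt j Dj; apply: (lc_mul (cR j Dj)); [apply: ss | apply: tt].
- by move=> s s' t t' ss tt j Dj; apply: (lc_ldiv (cR j Dj)); [apply: ss | apply: tt].
- by move=> s s' t t' ss tt j Dj; apply: (lc_rdiv (cR j Dj)); [apply: ss | apply: tt].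
- by move=> s t j /cR/lc_lmulKdiv.
- by move=> s t j /cR/lc_ldivKmul.
- by move=> s t j /cR/lc_rdivKmul.
- by move=> s t j /cR/lc_rmulKdiv.
- by move=> s j /cR/lc_mul1x.
- by move=> s j /cR/lc_mulx1.
Qed.

Lemma meet_congr R S : loop_congr R -> loop_congr S -> loop_congr (meet R S).
Proof.
move=> cR cS.
have -> : meet R S = fun s t => forall b : bool, True -> (if b then R else S) s t.
  apply/funext => s; apply/funext => t; apply/propext; split.
    by case=> ? ? [].
  by move=> h; split; [exact: (h true) | exact: (h false)].
by apply: bigmeet_congr; case.
Qed.

(* The Mal'cev term [s (t \ u)]. *)
Lemma comp_swap R S s u :
  loop_congr R -> loop_congr S -> comp R S s u -> comp S R s u.
Proof.
move=> cR cS [t st tu]; exists (Mul s (Ldiv t u)).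
- apply: (lc_sym cS); apply: (lc_trans cS (t := Mul s (Ldiv t t))).
    by apply: (lc_mul cS); [|apply: (lc_ldiv cS); [|apply: (lc_sym cS)]] => //; apply: (lc_refl cS).
  have tt1 : S (Ldiv t t) One.
    apply: (lc_trans cS (t := Ldiv t (Mul t One))); last exact: (lc_ldivKmul cS).
    by apply: (lc_ldiv cS); [exact: (lc_refl cS)|apply: (lc_sym cS); exact: (lc_mulx1 cS)].
  apply: (lc_trans cS (t := Mul s One)); last exact: (lc_mulx1 cS).
  by apply: (lc_mul cS) => //; apply: (lc_refl cS).
- apply: (lc_trans cR (t := Mul t (Ldiv t u))); last exact: (lc_lmulKdiv cR).
  by apply: (lc_mul cR) => //; apply: (lc_refl cR).
Qed.

Lemma comp_l R S s t : loop_congr S -> R s t -> comp R S s t.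
Proof. by move=> cS st; exists t => //; apply: (lc_refl cS). Qed.

Lemma comp_r R S s t : loop_congr R -> S s t -> comp R S s t.
Proof. by move=> cR st; exists s => //; apply: (lc_refl cR). Qed.

(** Symmetry and transitivity rest on permutability, that is on [comp_swap]; the composite is thus
    the join of [R] and [S]. *)
Lemma comp_congr R S : loop_congr R -> loop_congr S -> loop_congr (comp R S).
Proof.
move=> cR cS; split.
- by move=> s; apply: comp_l => //; apply: (lc_refl cR).
- move=> s t st; have [u su ut] := comp_swap cR cS st.
  by exists u; [apply: (lc_sym cR) | apply: (lc_sym cS)].
- move=> t s u [v sv vt] [w tw wu].
  have [v' vv' v'w] : comp R S v w by apply: (comp_swap cS cR); exists t.
  by exists v'; [apply: (lc_trans cR sv) | apply: (lc_trans cS v'w)].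
- move=> s s' t t' [u su us'] [v tv vt'].
  by exists (Mul u v); [apply: (lc_mul cR) | apply: (lc_mul cS)].
- move=> s s' t t' [u su us'] [v tv vt'].
  by exists (Ldiv u v); [apply: (lc_ldiv cR) | apply: (lc_ldiv cS)].
- move=> s s' t t' [u su us'] [v tv vt'].
  by exists (Rdiv u v); [apply: (lc_rdiv cR) | apply: (lc_rdiv cS)].
- by move=> s t; apply: comp_l => //; apply: (lc_lmulKdiv cR).
- by move=> s t; apply: comp_l => //; apply: (lc_ldivKmul cR).
- by move=> s t; apply: comp_l => //; apply: (lc_rdivKmul cR).
- by move=> s t; apply: comp_l => //; apply: (lc_rmulKdiv cR).
- by move=> s; apply: comp_l => //; apply: (lc_mul1x cR).
- by move=> s; apply: comp_l => //; apply: (lc_mulx1 cR).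
Qed.

(** * Associativity modulo a congruence, and full composites *)

Lemma assoc_mod_congr R s s' t t' u u' : loop_congr R ->
  R s s' -> R t t' -> R u u' ->
  R (Mul s' (Mul t' u')) (Mul (Mul s' t') u') ->
  R (Mul s (Mul t u)) (Mul (Mul s t) u).
Proof.
move=> cR ss tt uu h.
apply: (lc_trans cR (t := Mul s' (Mul t' u'))); first by do 2?apply: (lc_mul cR).
apply: (lc_trans cR h); apply: (lc_sym cR); by do 2?apply: (lc_mul cR).
Qed.

Lemma assoc_mod_1l R s t u : loop_congr R -> R s One ->
  R (Mul s (Mul t u)) (Mul (Mul s t) u).
Proof.
move=> cR s1; apply: (assoc_mod_congr cR s1 (lc_refl cR t) (lc_refl cR u)).
apply: (lc_trans cR (lc_mul1x cR _)); apply: (lc_sym cR).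
by apply: (lc_mul cR); [exact: (lc_mul1x cR) | exact: (lc_refl cR)].
Qed.

Lemma assoc_mod_1m R s t u : loop_congr R -> R t One ->
  R (Mul s (Mul t u)) (Mul (Mul s t) u).
Proof.
move=> cR t1; apply: (assoc_mod_congr cR (lc_refl cR s) t1 (lc_refl cR u)).
apply: (lc_trans cR (t := Mul s u)).
  by apply: (lc_mul cR); [exact: (lc_refl cR) | exact: (lc_mul1x cR)].
by apply: (lc_mul cR); [exact: (lc_sym cR (lc_mulx1 cR _)) | exact: (lc_refl cR)].
Qed.

(* The commutator of [K1] and [K2] lies below their meet, and modulo [N] both
   are full, so the commutator of everything with itself lies below [N]. *)
Lemma associative_mod_meet N K1 K2 :
  loop_congr N -> loop_congr K1 -> loop_congr K2 ->
  full (comp N K1) -> full (comp N K2) ->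
  (forall s t, meet K1 K2 s t -> N s t) -> associative_mod N.
Proof.
move=> cN cK1 cK2 f1 f2 sub s t u.
have [s' ss' s'1] := f1 s One; have [t' tt' t'1] := f2 t One.
apply: (assoc_mod_congr cN ss' tt' (lc_refl cN u)); apply: sub.
by split; [apply: assoc_mod_1l | apply: assoc_mod_1m].
Qed.

(** The commutator argument makes [L] associative. If [K1] is not below [K2], then neither is [L]
    meet [K1], since [K2] is not associative; so it composes with [K2] to the full relation, and
    this forces [L] to be full. *)
Lemma full_comp_meet N K1 K2 :
  loop_congr N -> loop_congr K1 -> loop_congr K2 ->
  maximal_congr K2 -> ~ associative_mod K2 ->
  full (comp N K1) -> full (comp N K2) -> full (comp N (meet K1 K2)).
Proof.
move=> cN cK1 cK2 max2 nass f1 f2.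
have cK := meet_congr cK1 cK2.
have cL := comp_congr cN cK; set L := comp N (meet K1 K2) in cL *.
have NL s t : N s t -> L s t by apply: comp_l.
have KL s t : meet K1 K2 s t -> L s t by apply: comp_r.
have LK1 : full (comp L K1) by move=> s t; have [u /NL ? ?] := f1 s t; exists u.
have LK2 : full (comp L K2) by move=> s t; have [u /NL ? ?] := f2 s t; exists u.
have assL := associative_mod_meet cL cK1 cK2 LK1 LK2 KL.
have [sub12|f12] := max2 _ (comp_congr cK2 cK1) (fun s t => @comp_l _ _ s t cK1).
  (* Here [K1] lies below [K2], so the meet is [K1] itself. *)
  move=> s t; have [u su ut] := f1 s t; exists u => //; split=> //.
  by apply: sub12; apply: comp_r.
have cLK1 := meet_congr cL cK1.
have [sub|fM] := max2 _ (comp_congr cK2 cLK1) (fun s t => @comp_l _ _ s t cLK1).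
  (* Every term is [K2]-congruent to one in the [K1]-class of [One], which
     associates with all terms modulo [L] meet [K1]. *)
  case: nass => s t u.
  have [s' ss' s'1] := f12 s One.
  apply: (assoc_mod_congr cK2 ss' (lc_refl cK2 t) (lc_refl cK2 u)).
  apply: sub; apply: comp_r => //; split; first exact: assL.
  exact: assoc_mod_1l.
have L1 s : L s One.
  have [k sk k1] := LK1 s One.
  (* Both [k] and [m] are [K1]-congruent to [One], and they are [K2]-congruent to each other, so the
     meet relates them. *)
  have [m km [mL mK1]] := fM k One.
  apply: (lc_trans cL sk); apply: (lc_trans cL (t := m)) => //.
  by apply: KL; split=> //; apply: (lc_trans cK1 k1); apply: (lc_sym cK1).
by move=> s t; apply: (lc_trans cL (L1 s)); apply: (lc_sym cL).
Qed.

(** Induction on the list, adding one maximal congruence at a time; the empty meet is the full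
    relation. *)
Lemma full_comp_bigmeet (J : eqType) (r : seq J)
    (N : term -> term -> Prop) (K : J -> term -> term -> Prop) :
  loop_congr N ->
  (forall j, j \in r -> [/\ loop_congr (K j), maximal_congr (K j),
                            ~ associative_mod (K j) & full (comp N (K j))]) ->
  full (comp N (fun s t => forall j, j \in r -> K j s t)).
Proof.
move=> cN; elim: r => [|j r IH] Kr.
  by move=> s t; exists s => //; apply: (lc_refl cN).
have Kr' i : i \in r -> _ := fun ir => Kr i (mem_behead (s := j :: r) ir).
have [cK mK aK fK] := Kr j (mem_head j r).
have cB : loop_congr (fun s t => forall i, i \in r -> K i s t).
  by apply: bigmeet_congr => i /Kr'[].
have F := full_comp_meet cN cB cK mK aK (IH Kr') fK.
move=> s t; have [u su [ut1 ut2]] := F s t.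
by exists u => // i; rewrite inE => /predU1P[->|/ut1].
Qed.

(** * The quotient of the term algebra by a congruence *)

Section Quotient.
Variables (R : term -> term -> Prop) (cR : loop_congr R).

(** Classes are sets of terms, so extensionality gives their equality; the operations go through
    representatives picked by choice. *)
Let Q := {C : set term | exists t, C = R t}.

Definition class (t : term) : Q := exist _ (R t : set term) (ex_intro _ t erefl).
Definition repr (C : Q) : term := sval (cid (svalP C)).

Lemma classP s t : class s = class t <-> R s t.
Proof.
split=> [[e]|st]; first by rewrite e; apply: (lc_refl cR).
apply: eq_exist; apply/funext => u; apply/propext; split=> h.
  exact: (lc_trans cR (lc_sym cR st) h).
exact: (lc_trans cR st h).
Qed.

Lemma reprK C : class (repr C) = C.
Proof.
rewrite /repr; case: cid => t /= e; case: C e => C HC /= e.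
exact: eq_exist.
Qed.

Lemma repr_class t : R (repr (class t)) t.
Proof. by apply/classP; rewrite reprK. Qed.

Definition quot_mul (C D : Q) := class (Mul (repr C) (repr D)).
Definition quot_ldiv (C D : Q) := class (Ldiv (repr C) (repr D)).
Definition quot_rdiv (C D : Q) := class (Rdiv (repr C) (repr D)).

Lemma quot_mulE s t : quot_mul (class s) (class t) = class (Mul s t).
Proof. by apply/classP; apply: (lc_mul cR); apply: repr_class. Qed.
Lemma quot_ldivE s t : quot_ldiv (class s) (class t) = class (Ldiv s t).
Proof. by apply/classP; apply: (lc_ldiv cR); apply: repr_class. Qed.
Lemma quot_rdivE s t : quot_rdiv (class s) (class t) = class (Rdiv s t).
Proof. by apply/classP; apply: (lc_rdiv cR); apply: repr_class. Qed.

Fact quot_lmulKdiv C D : quot_mul C (quot_ldiv C D) = D.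
Proof.
by rewrite -(reprK C) -(reprK D) quot_ldivE quot_mulE; apply/classP; exact: lc_lmulKdiv.
Qed.
Fact quot_ldivKmul C D : quot_ldiv C (quot_mul C D) = D.
Proof.
by rewrite -(reprK C) -(reprK D) quot_mulE quot_ldivE; apply/classP; exact: lc_ldivKmul.
Qed.
Fact quot_rdivKmul C D : quot_mul (quot_rdiv C D) D = C.
Proof.
by rewrite -(reprK C) -(reprK D) quot_rdivE quot_mulE; apply/classP; exact: lc_rdivKmul.
Qed.
Fact quot_rmulKdiv C D : quot_rdiv (quot_mul C D) D = C.
Proof.
by rewrite -(reprK C) -(reprK D) quot_mulE quot_rdivE; apply/classP; exact: lc_rmulKdiv.
Qed.
Fact quot_mul1x C : quot_mul (class One) C = C.
Proof. by rewrite -(reprK C) quot_mulE; apply/classP; exact: lc_mul1x. Qed.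
Fact quot_mulx1 C : quot_mul C (class One) = C.
Proof. by rewrite -(reprK C) quot_mulE; apply/classP; exact: lc_mulx1. Qed.

Definition quotient_loop : loop :=
  Loop quot_lmulKdiv quot_ldivKmul quot_rdivKmul quot_rmulKdiv
       quot_mul1x quot_mulx1.

End Quotient.

(** * Maximality of kernels *)

(** A congruence [S] above the kernel induces a homomorphism [f] from the image of the evaluation to
    the quotient by [S]; simplicity makes the kernel of [f] trivial or everything. *)
Lemma simple_maximal_congr (L : loop) (x y z : L) :
  is_simple (subloop (eval_range_subloop x y z)) ->
  maximal_congr (fun s t => eval x y z s = eval x y z t).
Proof.
set Y := subloop _ => simY S cS sub.
have evS (u : Y) : exists t, eval x y z t = sval u by have [t _ <-] := svalP u; exists t.
pose ev (t : term) : Y := exist _ (eval x y z t) (ex_intro2 _ _ t I erefl).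
pose f (u : Y) : quotient_loop cS := class S (sval (cid (evS u))).
(* Whichever preimage the choice in [f] returns, it is [S]-congruent to [t], as [S] contains the
   kernel of the evaluation. *)
have fE t : f (ev t) = class S t.
  by apply/(classP cS); apply: sub; case: cid.
have evK (u : Y) : exists t, u = ev t.
  by have [t tu] := evS u; exists t; case: u tu => u Hu /= tu; apply: eq_exist.
have evM s t : lmul (ev s) (ev t) = ev (Mul s t) by apply: eq_exist.
have evL s t : ldiv (ev s) (ev t) = ev (Ldiv s t) by apply: eq_exist.
have evR s t : rdiv (ev s) (ev t) = ev (Rdiv s t) by apply: eq_exist.
have ev1 : lone = ev One by apply: eq_exist.
have fhom : loop_hom f.
  split=> [u v|u v|u v|]; last by rewrite ev1 fE.
  - have [[s ->] [t ->]] := conj (evK u) (evK v).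
    by rewrite evM !fE /= quot_mulE.
  - have [[s ->] [t ->]] := conj (evK u) (evK v).
    by rewrite evL !fE /= quot_ldivE.
  - have [[s ->] [t ->]] := conj (evK u) (evK v).
    by rewrite evR !fE /= quot_rdivE.
have S1 t : S t One <-> f (ev t) = lone by rewrite fE; apply: iff_sym; apply: classP.
have [k1|kT] := simY _ (ex_intro _ (quotient_loop cS) (ex_intro _ f (conj fhom erefl))).
- left=> s t st.
  (* [S s t] puts the value of [Rdiv s t] in the kernel of [f], here trivial, so [s] and [t] have
     the same value. *)
  have : [set u | f u = lone] (ev (Rdiv s t)).
    apply/S1; apply: (lc_trans cS (t := Rdiv t t)).
      by apply: (lc_rdiv cS) => //; apply: (lc_refl cS).
    apply: (lc_trans cS (t := Rdiv (Mul One t) t)); last exact: (lc_rmulKdiv cS).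
    apply: (lc_rdiv cS); last exact: (lc_refl cS).
    by apply: (lc_sym cS); apply: (lc_mul1x cS).
  rewrite k1 => /(congr1 sval) /= e.
  by rewrite -[LHS](rdivKmul _ (eval x y z t)) e lmul1x.
- right.
  have T1 t : S t One.
    by apply/S1; have : [set: Y] (ev t) by []; rewrite -kT.
  by move=> s t; apply: (lc_trans cS (T1 s)); apply: (lc_sym cS).
Qed.

(** [comp N K] lies above [K] and contains a pair outside [K]. *)
Lemma full_comp_maximal N K s t : loop_congr N -> loop_congr K ->
  maximal_congr K -> N s t -> ~ K s t -> full (comp N K).
Proof.
move=> cN cK maxK Nst nK.
have [sub|//] := maxK _ (comp_congr cN cK) (fun s t => @comp_r _ _ s t cN).
by case: nK; apply: sub; apply: comp_l.
Qed.

(** * Triples in the generators and the final argument *)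

Lemma finite_triples (n : nat) (X : 'I_n -> loop) :
  (forall i, finite_set [set: X i]) ->
  finite_set [set: {i : 'I_n & (X i * X i * X i)%type}].
Proof.
move=> finX.
have : finite_set (\bigcup_(i in [set: 'I_n])
    (existT (fun i => (X i * X i * X i)%type) i) @` (([set: X i] `*` [set: X i]) `*` [set: X i])).
  apply: bigcup_finite => // i _.
  by apply: finite_image; do 2?apply: finite_setX.
apply: sub_finite_set => -[i t] _.
by exists i => //; exists t.
Qed.

Theorem corollary6p4 (n : nat) (X : 'I_n -> loop)
  (finX : forall i, finite_set [set: X i]%classic)
  (propX : forall i, assoc_propagates (X i))
  (subX : forall (i : 'I_n) (S : set (X i)) (HS : is_subloop S),
     is_abelian (subloop HS) \/
     (~ is_abelian (subloop HS) /\ is_simple (subloop HS))) :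
  assoc_propagates_in (variety_join (HSP X) abelian_groups).
Proof.
move=> Z VZ a b c abc.
(* [E] is the relation [K] meet [M]. *)
pose E s t := (forall i, satisfies (X i) s t) /\
  (forall A, is_abelian A -> satisfies A s t).
have EZ s t : E s t -> satisfies Z s t.
  apply: (VZ (fun L => forall s t, E s t -> satisfies L s t)).
    exact: models_variety.
  move=> Y [HY|abY] {}s {}t [EX EA]; last exact: EA.
  apply: (HY (fun L => forall s t, E s t -> satisfies L s t)) => //.
    exact: models_variety.
  by move=> _ [i ->] s' t' [].
pose J : eqType := {classic {i : 'I_n & (X i * X i * X i)%type}}.
pose ev (j : J) := let: existT i (x, y, z) := j in
  fun s t => eval x y z s = eval x y z t.
have cev j : loop_congr (ev j) by case: j => i [[x y] z]; apply: eval_congr.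
pose lhs := Mul Var1 (Mul Var2 Var3); pose rhs := Mul (Mul Var1 Var2) Var3.
have ass_ev j : ev j lhs rhs -> associative_mod (ev j).
  case: j => i [[x y] z] /= e s t u.
  by apply: (propX i x y z e); rewrite generated_eval; eexists.
have max_ev j : ~ ev j lhs rhs -> maximal_congr (ev j).
  case: j => i [[x y] z] /= e; apply: simple_maximal_congr.
  (* The values at a non-associating triple form a subloop that is not a group, hence a simple
     one. *)
  have [[ass _]|[]//] := subX i _ (eval_range_subloop x y z).
  case: e; pose g t := exist (range (eval x y z)) _ (ex_intro2 _ _ t I erefl).
  exact: (congr1 sval (ass (g Var1) (g Var2) (g Var3))).
pose N s t := eval a b c s = eval a b c t.
have cN : loop_congr N by apply: eval_congr.
have [r rT] : exists r : seq J, [set: J] = [set` r].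
  by apply/finite_seqP; apply: finite_triples.
pose r' := [seq j <- r | `[< ~ ev j lhs rhs >]].
have fK : full (comp N (fun s t => forall j, j \in r' -> ev j s t)).
  apply: full_comp_bigmeet => // j; rewrite mem_filter => /andP[/asboolP nj _].
  split=> //; [exact: max_ev | by move/(_ Var1 Var2 Var3) | ].
  exact: (full_comp_maximal (s := lhs) (t := rhs) cN (cev j) (max_ev j nj) abc nj).
have assN : associative_mod N.
  move=> s t u.
  (* The term [s'] has trivial value at every non-associating triple. So [s'], [t], [u] associate in
     each [X i], by propagation at the other triples, and in abelian groups; [EZ] carries this
     identity to [Z]. *)
  have [s' ss' s'1] := fK s One.
  apply: (assoc_mod_congr cN ss' (lc_refl cN t) (lc_refl cN u)); apply: EZ; split; last first.
    by move=> A [assA _] x y z /=; apply: assA.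
  move=> i x y z; pose j : J := existT _ i (x, y, z).
  change (ev j (Mul s' (Mul t u)) (Mul (Mul s' t) u)).
  have [/ass_ev//|nj] := pselect (ev j lhs rhs).
  apply: (assoc_mod_1l _ _ (cev j)); apply: s'1.
  rewrite mem_filter; apply/andP; split; first exact/asboolP.
  by have : [set: J] j by []; rewrite rT.
move=> u v w; rewrite generated_eval => -[s _ <-] [t _ <-] [q _ <-].
exact: assN.
Qed.
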